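(* If $1\le p\le 2$ and $G$ is a graph of order $n$ and size $m\ge n/2$, then $$\|G\|_{S_p}^p\le (2m/n)^p+(n-1)^{1-p/2}\left(2m-(2m/n)^2\right)^{p/2}.$$ Equality holds if and only if $G$ is either $(n/2)K_2$, or $K_n$, or a noncomplete strongly regular graph whose nontrivial eigenvalues are $$\pm\left(\frac{2m-(2m/n)^2}{n-1}\right)^{1/2}.$$
   Context: Graphs are finite, simple and undirected; the order of a graph is its number of vertices and its size is its number of edges. $K_n$ is the complete graph of order $n$ and $(n/2)K_2$ is the disjoint union of $n/2$ edges ($n$ even). The nontrivial eigenvalues of a strongly regular graph are the eigenvalues of its adjacency matrix other than the one equal to the vertex degree with the all-ones eigenvector. For a graph $G$ of order $n$ with adjacency matrix $A$, let $\sigma_1(G)\ge\cdots\ge\sigma_n(G)$ be the singular values of $A$ (the absolute values of its eigenvalues), and for real $p\ge1$ let $\|G\|_{S_p}=\left(\sigma_1^p(G)+\cdots+\sigma_n^p(G)\right)^{1/p}$ be the Schatten $p$-norm.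
   Formalization: The equality characterization is stated only for 1 ≤ p < 2 (the inequality for 1 ≤ p ≤ 2): at p = 2 both sides equal 2m for every graph, so the ''only if'' fails, e.g. for the path on 3 vertices. *)

(* Defs.v *)
From mathcomp Require Import all_boot all_order all_algebra.
From mathcomp Require Import polyrcf reals exp.

Set Implicit Arguments.
Unset Strict Implicit.
Unset Printing Implicit Defensive.

Import Order.TTheory GRing.Theory Num.Theory.
Local Open Scope ring_scope.

Record sgraph := SGraph {
  vertex :> finType;
  adj : rel vertex;
  adj_sym : symmetric adj;
  adj_irr : irreflexive adj
}.

Definition gorder (G : sgraph) : nat := #|G|.

Definition edges (G : sgraph) : {set {set G}} :=
  [set e : {set G} | [exists x, [exists y, adj x y && (e == [set x; y])]]].

Definition gsize (G : sgraph) : nat := #|edges G|.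

Definition graph_iso (G H : sgraph) : Prop :=
  exists2 f : G -> H, bijective f & forall x y, adj (f x) (f y) = adj x y.

Lemma complete_sym n : symmetric (fun i j : 'I_n => i != j).
Proof. by move=> i j; rewrite eq_sym. Qed.

Lemma complete_irr n : irreflexive (fun i j : 'I_n => i != j).
Proof. by move=> i; rewrite eqxx. Qed.

Definition complete_graph (n : nat) : sgraph :=
  SGraph (@complete_sym n) (@complete_irr n).

Lemma copiesK2_sym k :
  symmetric (fun u v : 'I_k * bool => (u.1 == v.1) && (u.2 != v.2)).
Proof. by move=> u v; rewrite eq_sym [u.2 == _]eq_sym. Qed.

Lemma copiesK2_irr k :
  irreflexive (fun u v : 'I_k * bool => (u.1 == v.1) && (u.2 != v.2)).
Proof. by move=> u; rewrite !eqxx. Qed.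

(* k K_2, the disjoint union of the k edges {(i, false), (i, true)} *)
Definition copiesK2 (k : nat) : sgraph :=
  SGraph (@copiesK2_sym k) (@copiesK2_irr k).

Definition strongly_regular (G : sgraph) (k a c : nat) : Prop :=
  [/\ forall x : G, #|[set z | adj x z]| = k,
      forall x y : G, adj x y -> #|[set z | adj x z && adj y z]| = a
    & forall x y : G, x != y -> ~~ adj x y ->
        #|[set z | adj x z && adj y z]| = c].

Definition adjmx (R : realType) (G : sgraph) : 'M[R]_#|G| :=
  \matrix_(i, j) (adj (enum_val i) (enum_val j))%:R.

(* The real eigenvalues, each repeated according to its algebraic             *)
(* multiplicity; for a symmetric matrix these are all n eigenvalues.          *)
Definition spectrum (R : realType) (n : nat) (A : 'M[R]_n) : seq R :=
  flatten [seq nseq (mup x (char_poly A)) x | x <- rootsR (char_poly A)].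

Definition singular_values (R : realType) (n : nat) (A : 'M[R]_n) : seq R :=
  sort >=%R [seq Num.sqrt x | x <- spectrum (A^T *m A)].

Definition schatten_norm (R : realType) (p : R) (G : sgraph) : R :=
  powR (\sum_(s <- singular_values (adjmx R G)) powR s p) p^-1.

(* For a k-regular graph, rem discards one copy only of k (the one belonging  *)
(* to the all-ones vector); if G is disconnected, k remains in the list.      *)
Definition nontrivial_eigenvalues (R : realType) (G : sgraph) (k : nat) :
    seq R :=
  rem k%:R (spectrum (adjmx R G)).

(* Main.v *)
Require Import Defs.
From mathcomp Require Import all_boot all_order all_algebra.
From mathcomp Require Import polyrcf reals exp.
From mathcomp Require Import complex sequences.
From mathcomp Require Import ring lra.
Import Order.TTheory GRing.Theory Num.Theory.
Local Open Scope ring_scope.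

(* Let A be the adjacency matrix, with eigenvalues r_i, and let d = 2m/n. The
   p-th power of the Schatten norm is the sum of the (r_i^2)^(p/2), where
   the r_i^2 are nonnegative numbers of sum nd, one of which is at least d^2 by
   the Rayleigh quotient of the all-ones vector. The bound follows by majorising
   the concave function t |-> t^(p/2) by its tangents at d^2 and at
   tau = (nd - d^2)/(n-1).
   When p < 2, equality forces the largest eigenvalue to be d and r_i^2 = tau
   for the others. The Rayleigh quotient is then attained, so G is regular; and
   A^2 - tau I is a multiple of the all-ones matrix, so any two distinct
   vertices have the same number of common neighbours. As the trace of A is 0,
   both signs occur among the other eigenvalues unless G is complete. *)

Set Implicit Arguments.
Unset Strict Implicit.

(** * Unitary diagonalisation of real symmetric matrices *)

Section Spectrum.
Local Open Scope sesquilinear_scope.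
Local Open Scope complex_scope.

Variable R : realType.
Local Notation toC := (real_complex R).

(** [rootsR] has no repetitions, so each root [x] gets a single block in [spectrum], and both lists
    contain it [mup x] times. *)
Lemma perm_spectrum n (A : 'M[R]_n) (s : seq R) :
  char_poly A = \prod_(x <- s) ('X - x%:P) -> perm_eq (spectrum A) s.
Proof.
move=> charA; apply/allP => x _ /=.
have cA0 : char_poly A != 0 by rewrite charA monic_neq0 ?monic_prod_XsubC.
have rA := roots_on_rootsR cA0.
have uA : uniq (rootsR (char_poly A)) by exact: uniq_roots.
apply/eqP; rewrite -(mu_prod_XsubC x s) -charA /spectrum count_flatten -map_comp.
rewrite sumnE big_map.
rewrite (eq_bigr (fun y => if y == x then mup x (char_poly A) else 0)%N); last first.
  by move=> y _ /=; rewrite count_nseq /=; case: eqP => [->|]; rewrite ?mul1n.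
rewrite -big_mkcond /= -big_filter.
have [xA|xA] := boolP (x \in rootsR (char_poly A)).
  by rewrite [[seq _ <- _ | _]](filter_pred1_uniq uA xA) big_seq1.
rewrite big1_seq => [|y]; last first.
  by rewrite mem_filter /= => /andP[/eqP-> /(negP xA)].
by rewrite mupNroot //; move: xA; rewrite -rA inE.
Qed.

(** [P] is a parameter so that [A], [A *m A] and their shifts by scalar matrices can share one
    eigenbasis, the conjugated rows of [P]. *)
Definition diagonalizes n (P : 'M[R[i]]_n) (A : 'M[R]_n) (r : 'I_n -> R) :=
  P \is unitarymx /\
  map_mx toC A = P^t* *m diag_mx (\row_i toC (r i)) *m P.

Lemma diagonalizes_symmetric n (A : 'M[R]_n) :
  A^T = A -> exists P r, diagonalizes P A r.
Proof.
move=> symA; pose B := map_mx toC A.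
have hB : B \is hermsymmx.
  apply/is_hermitianmxP; rewrite expr0 scale1r; apply/matrixP => i j.
  by rewrite !mxE -{1}symA mxE; apply/esym/conjc_real.
have /orthomx_spectralP := hermitian_normalmx hB.
set P := spectralmx B; set D := spectral_diag B => BE.
have Pu : P \is unitarymx := spectral_unitarymx _.
(* A Hermitian matrix has real eigenvalues, so taking real parts loses nothing. *)
exists P, (fun i => complex.Re (D 0 i)); split; first exact: Pu.
rewrite -/B {1}BE (invmx_unitary Pu).
suff <- : D = \row_i (complex.Re (D 0 i))%:C by [].
apply/rowP => i; rewrite !mxE.
have /mxOverP/(_ 0 i) := hermitian_spectral_diag_real hB.
by rewrite -/D; case: (D 0 i) => a b /complex_realP[c [-> ->]].
Qed.

Lemma diagonalizes_mul n (P : 'M_n) (A B : 'M[R]_n) r s :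
  diagonalizes P A r -> diagonalizes P B s ->
  diagonalizes P (A *m B) (fun i => r i * s i).
Proof.
move=> [Pu AE] [_ BE]; split; first exact: Pu.
rewrite map_mxM /= AE BE !mulmxA.
rewrite (mulmxtVK _ Pu) -[_ *m diag_mx _ *m diag_mx _]mulmxA mulmx_diag.
suff -> : \row_i (r i * s i)%:C
  = \row_i ((\row_i (r i)%:C) 0 i * (\row_i (s i)%:C) 0 i) by [].
by apply/rowP => i; rewrite !mxE rmorphM.
Qed.

Lemma diagonalizes_sub n (P : 'M_n) (A B : 'M[R]_n) r s :
  diagonalizes P A r -> diagonalizes P B s ->
  diagonalizes P (A - B) (fun i => r i - s i).
Proof.
move=> [Pu AE] [_ BE]; split; first exact: Pu.
rewrite map_mxB AE BE -mulmxBl -mulmxBr -linearB.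
suff -> : \row_i (r i - s i)%:C = \row_i (r i)%:C - \row_i (s i)%:C by [].
by apply/rowP => i; rewrite !mxE rmorphB.
Qed.

Lemma diagonalizes_scalar n (P : 'M_n) (A : 'M[R]_n) r (c : R) :
  diagonalizes P A r -> diagonalizes P c%:M (fun=> c).
Proof.
move=> [Pu _]; split; first exact: Pu.
rewrite map_scalar_mx.
have -> : \row_(i < n) c%:C = const_mx c%:C by apply/rowP => i; rewrite !mxE.
rewrite diag_const_mx mul_mx_scalar -scalemxAl.
by rewrite -invmx_unitary // mulVmx ?unitarymx_unit // scalemx1.
Qed.

Lemma diagonalizes_spectrum n (P : 'M_n) (A : 'M[R]_n) r :
  diagonalizes P A r -> perm_eq (spectrum A) [seq r i | i <- enum 'I_n].
Proof.
move=> [Pu AE]; apply: perm_spectrum.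
apply: (map_poly_inj toC); rewrite map_char_poly AE.
rewrite rmorph_prod /= big_map big_enum /=.
have PV : P^t* *m P = 1%:M by rewrite -invmx_unitary // mulVmx ?unitarymx_unit.
rewrite /char_poly /char_poly_mx !map_mxM /=.
(* The conjugation by [P] factors out of the characteristic matrix and then cancels in the
   determinant. *)
have -> : 'X%:M - map_mx polyC (P^t*) *m map_mx polyC (diag_mx (\row_i (r i)%:C))
    *m map_mx polyC P
  = map_mx polyC (P^t*) *m char_poly_mx (diag_mx (\row_i (r i)%:C))
    *m map_mx polyC P.
  rewrite /char_poly_mx mulmxBr mulmxBl; congr (_ - _).
  by rewrite mul_mx_scalar -scalemxAl -map_mxM PV map_mx1 scalemx1.
rewrite !det_mulmx mulrAC -det_mulmx -map_mxM PV map_mx1 det1 mul1r.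
rewrite -/(char_poly _) char_poly_trig ?diag_mx_is_trig //.
by apply: eq_bigr => i _; rewrite !mxE eqxx rmorphB /= map_polyX map_polyC.
Qed.

Lemma diagonalizes_eq0 n (P : 'M_n) (A : 'M[R]_n) r :
  diagonalizes P A r -> (forall i, r i = 0) -> A = 0.
Proof.
move=> [_ AE] r0; apply: (@map_mx_inj _ _ toC); rewrite map_mx0 AE.
have -> : \row_i (r i)%:C = 0 by apply/rowP => i; rewrite !mxE r0.
by rewrite linear0 mulmx0 mul0mx.
Qed.

Lemma diagonalizes_trace n (P : 'M_n) (A : 'M[R]_n) r :
  diagonalizes P A r -> \tr A = \sum_i r i.
Proof.
move=> [Pu AE]; apply: (@complexI R).
rewrite -trace_map_mx AE mxtrace_mulC mulmxA (unitarymxP Pu) mul1mx.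
by rewrite mxtrace_diag rmorph_sum; apply: eq_bigr => i _; rewrite mxE.
Qed.

Lemma normc_sqrE (z : R[i]) : (Normc.normc z ^+ 2)%:C = z^* * z.
Proof.
case: z => a b; rewrite /= sqr_sqrtr ?addr_ge0 ?sqr_ge0 //; simpc.
by congr (_ +i* _); ring.
Qed.

(** The squared modulus of the coordinate of the all-ones vector along the [i]-th eigenvector. *)
Definition ones_weight n (P : 'M[R[i]]_n) (i : 'I_n) : R :=
  Normc.normc (\sum_j P i j) ^+ 2.

(** Both sides are the quadratic form of [A] at the all-ones vector, computed in the eigenbasis and
    in the standard basis. *)
Lemma ones_weight_sum n (P : 'M_n) (A : 'M[R]_n) r :
  diagonalizes P A r ->
  \sum_i ones_weight P i * r i = \sum_i \sum_j A i j.
Proof.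
move=> [Pu AE]; apply: (@complexI R); rewrite !rmorph_sum /=.
transitivity (\sum_x \sum_y (map_mx toC A) x y); last first.
  by apply: eq_bigr => x _; rewrite rmorph_sum; apply: eq_bigr => y _; rewrite mxE.
rewrite AE.
under [RHS]eq_bigr => x _ do under eq_bigr => y _ do rewrite mxE.
under [RHS]eq_bigr => x _ do rewrite exchange_big /=.
rewrite exchange_big /=; apply: eq_bigr => i _.
have -> : (ones_weight P i * r i)%:C
    = (\sum_j P i j)^* * (r i)%:C * (\sum_j P i j).
  rewrite /ones_weight rmorphM mulrAC; congr (_ * _); exact: normc_sqrE.
rewrite rmorph_sum !mulr_suml; apply: eq_bigr => x _.
rewrite mulr_sumr; apply: eq_bigr => y _; congr (_ * _).
rewrite mul_mx_diag !mxE //.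
Qed.

(** The all-ones vector is orthogonal to every eigenvector but the [i0]-th, hence proportional to
    it, and [A] is a multiple of the projection onto that line. *)
Lemma rank_one_const n (P : 'M_n) (A : 'M[R]_n) r i0 :
  diagonalizes P A r -> (forall i, i != i0 -> r i = 0) ->
  (forall i, i != i0 -> ones_weight P i = 0) ->
  forall x y x' y', A x y = A x' y'.
Proof.
move=> [Pu AE] r0 w0.
have AP x y : (A x y)%:C = (P i0 x)^* * (r i0)%:C * P i0 y.
  have -> : (A x y)%:C = (map_mx toC A) x y by rewrite mxE.
  rewrite AE mxE (bigD1 i0) //= big1 ?addr0 => [|i ii0].
    by rewrite mul_mx_diag !mxE.
  by rewrite mul_mx_diag !mxE r0 // mulr0 mul0r.
have v0 i : i != i0 -> \sum_j P i j = 0.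
  move=> /w0/eqP; rewrite expf_eq0 /= => /eqP.
  exact: Normc.eq0_normc.
(* A row sum of [P^t* *m P = 1], in which [v0] kills every term but that of [i0]. It forces the
   entries of row [i0] of [P] to be equal. *)
have P1 x : (P i0 x)^* * (\sum_j P i0 j) = 1.
  have PV : P^t* *m P = 1%:M by rewrite -invmx_unitary // mulVmx ?unitarymx_unit.
  have : \sum_y (P^t* *m P) x y = 1.
    rewrite PV (bigD1 x) //= mxE eqxx big1 ?addr0 // => y yx.
    by rewrite mxE eq_sym (negPf yx).
  under eq_bigr => y _ do rewrite mxE.
  rewrite exchange_big (bigD1 i0) //= [X in _ + X]big1 ?addr0 => [|i ii0].
    by move=> <-; rewrite mulr_sumr; apply: eq_bigr => y _; rewrite !mxE.
  by rewrite -mulr_sumr v0 // mulr0.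
have Pc x y : P i0 x = P i0 y.
  have s0 : \sum_j P i0 j != 0.
    by apply/eqP => s0; have := P1 x; rewrite s0 mulr0 => /esym/eqP; rewrite oner_eq0.
  by apply: (inv_inj (@conjcK R)); apply: (mulIf s0); rewrite !P1.
move=> x y x' y'; apply: (@complexI R).
by rewrite /= !AP (Pc x x') (Pc y y').
Qed.

End Spectrum.

(** * Sums of concave powers under a fixed total *)

Section PowerSums.
Variable R : realType.
Implicit Types q s t x y : R.

(* With [1 - q] read as [(1 - q) * expR 0], both values of [expR] on the right
   are minorised by its tangent at [q * y]. *)
Lemma expR_secant q y : 0 < q -> q <= 1 ->
  expR (q * y) <= 1 - q + q * expR y
  /\ (q < 1 -> expR (q * y) = 1 - q + q * expR y -> y = 0).
Proof.
move=> q0 q1; set z := q * y.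
have e1 : expR y = expR z * expR (y - z) by rewrite -expRD addrC subrK.
have e2 : 1 = expR z * expR (- z) by rewrite -expRD subrr expR0.
have z0 := expR_gt0 z.
have t1 := expR_ge1Dx (y - z); have t2 := expR_ge1Dx (- z).
have H : 1 - q + q * expR y - expR z
   = expR z * (q * (expR (y - z) - (1 + (y - z))) + (1 - q) * (expR (- z) - (1 - z))).
  rewrite e1 -[1 - q]mulr1 {2}e2 /z; ring.
split.
  rewrite -subr_ge0 H; apply: mulr_ge0; first exact: ltW.
  by apply: addr_ge0; apply: mulr_ge0; lra.
move=> q1' E; have [//|y0] := eqVneq y 0.
have z1 : - z != 0 by rewrite oppr_eq0 mulf_neq0 // lt0r_neq0.
have t3 := expR_gt1Dx z1.
suff : 0 < 1 - q + q * expR y - expR z by rewrite E subrr ltxx.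
rewrite H; apply: mulr_gt0 => //; apply: ltr_wpDl.
  by apply: mulr_ge0; lra.
by apply: mulr_gt0; lra.
Qed.

(** Writing [t = s * expR y] and dividing by [powR s q] reduces this to [expR_secant]. *)
Lemma powR_tangent q s t : 0 < q -> q <= 1 -> 0 < s -> 0 <= t ->
  powR t q <= powR s q + q * powR s (q - 1) * (t - s)
  /\ (q < 1 -> powR t q = powR s q + q * powR s (q - 1) * (t - s) -> t = s).
Proof.
move=> q0 q1 s0 t0.
have sq : powR s q = s * powR s (q - 1) by rewrite mulr_powRB1 // ltW.
have sp : 0 < powR s (q - 1) by rewrite powR_gt0.
(* The value [t = 0] is not of the form [s * expR y]; there the gap is [(1 - q) * powR s q],
   positive when [q < 1]. *)
move: t0; rewrite le_eqVlt => /orP[/eqP<-|t0].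
  rewrite powR0 ?lt0r_neq0 // sq.
  have -> : s * powR s (q - 1) + q * powR s (q - 1) * (0 - s)
    = (1 - q) * (s * powR s (q - 1)) by ring.
  split=> [|q1' /esym/eqP].
    by rewrite mulr_ge0 ?mulr_ge0 ?subr_ge0 // ltW.
  by rewrite !mulf_eq0 (gt_eqF s0) (gt_eqF sp) orbF orbF subr_eq0 gt_eqF.
have [y yE] := expR_total (divr_gt0 t0 s0).
have tE : t = s * expR y by rewrite yE mulrC divfK // lt0r_neq0.
have -> : powR t q = powR s q * expR (q * y).
  by rewrite tE powRM ?expR_ge0 ?(ltW s0) // -expRM [y * q]mulrC.
have -> : powR s q + q * powR s (q - 1) * (t - s)
   = powR s q * (1 - q + q * expR y) by rewrite sq tE; ring.
have sq0 : 0 < powR s q by rewrite powR_gt0.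
have [le eq] := expR_secant y q0 q1.
split; first by rewrite ler_pM2l.
move=> q1' /(mulfI (lt0r_neq0 sq0)) /(eq q1') y0.
by rewrite tE y0 expR0 mulr1.
Qed.

Lemma powR_slope_le q s t : q <= 1 -> 0 < s -> s <= t ->
  powR t (q - 1) <= powR s (q - 1).
Proof.
move=> q1 s0 st; have t0 := lt_le_trans s0 st.
rewrite -[q - 1]opprB !powRN lef_pV2 ?posrE ?powR_gt0 //.
by rewrite ge0_ler_powR ?nnegrE ?subr_ge0 // ltW.
Qed.

(** The extremal configuration. It serves both to rewrite the bound as a sum of powers and to verify
    equality for the extremal graphs. *)
Lemma sum_powR_const (I : finType) (i0 : I) (t : I -> R) (T q D : R) :
  t i0 = D ^+ 2 -> (forall i, i != i0 -> t i = T / (#|I|%:R - 1)) ->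
  0 <= T -> 0 <= D -> (1 < #|I|)%N ->
  \sum_i powR (t i) q
    = powR D (2 * q) + powR (#|I|%:R - 1) (1 - q) * powR T q.
Proof.
move=> t0 tT T0 D0 I1.
have N1 : (1 : R) < #|I|%:R by rewrite ltr1n.
have M0 : 0 < #|I|%:R - 1 :> R by rewrite subr_gt0.
rewrite (bigD1 i0) //= t0 powRrM powR_mulrn //; congr (_ + _).
under eq_bigr => i ii0 do rewrite (tT i ii0).
rewrite sumr_const cardC1 -[_ *+ _.-1]mulr_natl -subn1 natrB ?(ltnW I1) //.
rewrite [T / _]mulrC powRM ?invr_ge0 ?(ltW M0) // mulrA; congr (_ * _).
rewrite powRB ?(gt_eqF M0) ?implybT // powRr1 ?ltW //; congr (_ * _).
by rewrite -powR_inv1 ?ltW // powRAC powR_inv1 // powR_ge0.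
Qed.

(* Majorise [powR _ q] by its tangents at [D ^+ 2] (for the index [i0]) and at
   the common value [tau] (for all the others): since [tau <= D ^+ 2], the first
   slope is the smaller one, so that letting [t i0] exceed [D ^+ 2] only loses. *)
Lemma sum_powR_le (I : finType) (i0 : I) (t : I -> R) (q D : R) :
  0 < q -> q <= 1 -> 1 <= D -> D < #|I|%:R ->
  (forall i, 0 <= t i) -> \sum_i t i = #|I|%:R * D -> D ^+ 2 <= t i0 ->
  let T := #|I|%:R * D - D ^+ 2 in
  let bound := powR D (2 * q) + powR (#|I|%:R - 1) (1 - q) * powR T q in
  \sum_i powR (t i) q <= bound
  /\ (q < 1 -> \sum_i powR (t i) q = bound ->
       t i0 = D ^+ 2 /\ forall i, i != i0 -> t i = T / (#|I|%:R - 1)).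
Proof.
move=> q0 q1 D1 DN tge0 sumt Dt T bound.
have I1 : (1 < #|I|)%N by rewrite -(ltr1n R); lra.
have M0 : 0 < #|I|%:R - 1 :> R by lra.
have D0 : 0 < D by lra.
have T0 : 0 < T by rewrite /T expr2 -mulrBl mulr_gt0 ?subr_gt0.
pose tau := T / (#|I|%:R - 1).
have tau0 : 0 < tau by rewrite divr_gt0.
(* After clearing the denominator this is [D * (D - 1) >= 0], up to the factor [#|I|]. *)
have tauD : tau <= D ^+ 2.
  rewrite ler_pdivrMr // -subr_ge0.
  have -> : D ^+ 2 * (#|I|%:R - 1) - T = #|I|%:R * (D * (D - 1)) by rewrite /T; ring.
  by rewrite !mulr_ge0 ?subr_ge0 // ltW.
pose s i := if i == i0 then D ^+ 2 else tau.
have s0 i : 0 < s i by rewrite /s; case: eqP => // _; exact: exprn_gt0.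
have boundE : bound = \sum_i powR (s i) q.
  by rewrite (sum_powR_const (i0 := i0) (T := T) q (D := D)) // /s ?eqxx; try lra;
    move=> i /negPf ->.
pose u i := powR (s i) q + q * powR (s i) (q - 1) * (t i - s i).
have tu i : powR (t i) q <= u i by have [] := powR_tangent q0 q1 (s0 i) (tge0 i).
have su : \sum_i u i <= bound.
  rewrite boundE big_split /= gerDl.
  (* [t] and [s] have the same total [#|I| * D], so the deviations away from [i0] balance the one at
     [i0]. *)
  have sums : \sum_(i | i != i0) (t i - s i) = - (t i0 - D ^+ 2).
    rewrite sumrB; move: sumt; rewrite (bigD1 i0) //=.
    have -> : \sum_(i | i != i0) s i = T.
      under eq_bigr => i /negPf ii0 do rewrite /s ii0.
      rewrite sumr_const cardC1 -[_ *+ _.-1]mulr_natl -subn1 natrB ?(ltnW I1) //.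
      by rewrite /tau mulrC divfK // gt_eqF.
    rewrite /T; lra.
  rewrite (bigD1 i0) //=.
  have -> : \sum_(i | i != i0) q * powR (s i) (q - 1) * (t i - s i)
     = q * powR tau (q - 1) * \sum_(i | i != i0) (t i - s i).
    by rewrite mulr_sumr; apply: eq_bigr => i /negPf ii0; rewrite {1}/s ii0.
  rewrite sums {1 2}/s eqxx.
  have := powR_slope_le q1 tau0 tauD.
  set a := powR tau _; set b := powR (D ^+ 2) _ => ba.
  have -> : q * b * (t i0 - D ^+ 2) + q * a * - (t i0 - D ^+ 2)
    = - (q * ((a - b) * (t i0 - D ^+ 2))) by ring.
  rewrite oppr_le0 mulr_ge0 ?mulr_ge0 ?subr_ge0 //; exact: ltW.
split; first by apply: le_trans su; apply: ler_sum => i _; exact: tu.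
move=> q1' E.
(* In the equality case the sum of the [u i] is squeezed onto that of the powers, so every tangent
   inequality is tight. *)
have ts i : t i = s i.
  have [_] := powR_tangent q0 q1 (s0 i) (tge0 i); apply=> //.
  have : \sum_i (u i - powR (t i) q) == 0.
    by rewrite sumrB subr_eq0 eq_le {1}E su ler_sum // => j _; exact: tu.
  rewrite psumr_eq0 => [/allP/(_ i)|j _]; last by rewrite subr_ge0.
  by rewrite mem_index_enum subr_eq0 => /(_ isT)/eqP.
by split=> [|i /negPf ii0]; rewrite ts /s ?eqxx ?ii0.
Qed.

End PowerSums.

(** * The all-ones vector, row sums and eigenvalues *)

Section OnesWeight.
Variables (R : realType) (n : nat) (P : 'M[R[i]]_n) (A : 'M[R]_n) (r : 'I_n -> R).
Hypotheses (symA : A^T = A) (dA : diagonalizes P A r).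

Lemma ones_weight_ge0 i : 0 <= ones_weight P i.
Proof. exact: sqr_ge0. Qed.

Lemma ones_weight_total : \sum_i ones_weight P i = n%:R.
Proof.
have := ones_weight_sum (diagonalizes_scalar 1 dA).
under eq_bigr do rewrite mulr1.
move->; rewrite -[in RHS](card_ord n) -sumr_const; apply: eq_bigr => i _.
rewrite (bigD1 i) //= mxE eqxx big1 ?addr0 // => j ji.
by rewrite mxE eq_sym (negPf ji).
Qed.

(** Both sides are the squared norm of the image of the all-ones vector under [A - c%:M]; symmetry
    identifies column sums with row sums. *)
Lemma ones_weight_sqr (c : R) :
  \sum_i ones_weight P i * (r i - c) ^+ 2 = \sum_i (\sum_j A i j - c) ^+ 2.
Proof.
have dB := diagonalizes_sub dA (diagonalizes_scalar c dA).
have := ones_weight_sum (diagonalizes_mul dB dB).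
set B := A - _ => wE.
have rowB i : \sum_j B i j = \sum_j A i j - c.
  under eq_bigr do rewrite /B mxE.
  rewrite big_split /=; congr (_ + _); rewrite (bigD1 i) //= !mxE eqxx.
  by rewrite big1 ?addr0 // => j ji; rewrite !mxE eq_sym (negPf ji) oppr0.
have colB j : \sum_i B i j = \sum_i A j i - c.
  rewrite -rowB; apply: eq_bigr => i _.
  by rewrite !mxE -[in LHS]symA mxE eq_sym.
under eq_bigr do rewrite expr2.
rewrite wE; under eq_bigr do under eq_bigr do rewrite mxE.
under eq_bigr do rewrite exchange_big.
rewrite exchange_big /=; apply: eq_bigr => k _.
under eq_bigr do rewrite -mulr_sumr rowB.
by rewrite -mulr_suml colB.
Qed.

(** Each condition says that the all-ones vector is an eigenvector for [c]: it is the vanishing of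
    one side of [ones_weight_sqr], a sum of nonnegative terms. *)
Lemma row_sum_constP (c : R) :
  (forall i, \sum_j A i j = c) <-> (forall i, ones_weight P i * (r i - c) = 0).
Proof.
have := ones_weight_sqr c => E; split=> H.
  move: E; rewrite [RHS]big1 => [|i _]; last by rewrite H subrr expr0n.
  move/eqP; rewrite psumr_eq0 => [/allP Hw i|i _]; last first.
    by rewrite mulr_ge0 ?sqr_ge0 ?ones_weight_ge0.
  have := Hw i (mem_index_enum _); rewrite /= mulf_eq0 [X in _ || X]sqrf_eq0.
  by rewrite -mulf_eq0 => /eqP.
move: E; rewrite big1 => [|i _]; last by rewrite expr2 mulrA H mul0r.
move/esym/eqP; rewrite psumr_eq0 => [/allP Hw i|i _]; last exact: sqr_ge0.
by have := Hw i (mem_index_enum _); rewrite /= sqrf_eq0 subr_eq0 => /eqP.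
Qed.

(** The weights add up to [n > 0], so one of them is nonzero, and its eigenvalue must be [c]. *)
Lemma row_sum_const_eigenvalue (c : R) : (0 < n)%N ->
  (forall i, \sum_j A i j = c) -> exists i, r i = c.
Proof.
move=> n0 /row_sum_constP H.
have [i wi|w0] := pickP (fun i => ones_weight P i != 0).
  exists i; have /eqP := H i; rewrite mulf_eq0 (negPf wi) /= subr_eq0.
  by move/eqP.
have := ones_weight_total; rewrite big1 => [/esym/eqP|i _].
  by rewrite pnatr_eq0 (gtn_eqF n0).
by have /negbT := w0 i; rewrite negbK => /eqP.
Qed.

(** Rayleigh bound: the sum of the entries averages the eigenvalues with nonnegative weights of
    total [n]. *)
Lemma mean_le_eigenvalue : (0 < n)%N -> exists i0,
  (forall i, r i <= r i0) /\ \sum_i \sum_j A i j <= n%:R * r i0.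
Proof.
move=> n0; pose i1 : 'I_n := Ordinal n0.
exists [arg max_(i > i1) r i]%O; case: arg_maxP => //= i0 _ rmax.
have {}rmax i : r i <= r i0 by exact: rmax.
split=> //; rewrite -(ones_weight_sum dA) -ones_weight_total mulr_suml.
by apply: ler_sum => i _; rewrite ler_wpM2l ?ones_weight_ge0.
Qed.

Lemma mean_eq_eigenvalue i0 : (forall i, r i <= r i0) ->
  \sum_i \sum_j A i j = n%:R * r i0 -> forall i, \sum_j A i j = r i0.
Proof.
move=> rmax; rewrite -(ones_weight_sum dA) -ones_weight_total mulr_suml => E.
apply/row_sum_constP => i.
have : \sum_i ones_weight P i * (r i0 - r i) == 0.
  under eq_bigr do rewrite mulrBr.
  by rewrite sumrB E subrr.
rewrite psumr_eq0 => [/allP/(_ i)|j _]; last first.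
  by rewrite mulr_ge0 ?ones_weight_ge0 ?subr_ge0.
by rewrite mem_index_enum -[r i - _]opprB mulrN => /(_ isT)/eqP->; rewrite oppr0.
Qed.

(** Passes from [rem], which deletes one occurrence of a value, to the deletion of an index. *)
Lemma nontrivial_spectrum i0 :
  perm_eq (rem (r i0) (spectrum A)) [seq r i | i <- enum 'I_n & i != i0].
Proof.
have dp := diagonalizes_spectrum dA.
have : perm_eq (spectrum A) (r i0 :: [seq r i | i <- enum 'I_n & i != i0]).
  apply: (perm_trans dp).
  rewrite -[r i0 :: _]/(map r (i0 :: _)); apply: perm_map.
  rewrite -rem_filter ?enum_uniq // perm_to_rem // mem_enum //.
move=> H; rewrite -(perm_cons (r i0)).
rewrite perm_sym (perm_trans _ (perm_to_rem _)) // 1?perm_sym //.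
by rewrite (perm_mem H) mem_head.
Qed.

End OnesWeight.

(** * Adjacency matrices, degrees and common neighbours *)

Section Adjacency.
Variables (R : realType) (G : sgraph).
Local Notation A := (adjmx R G).

Definition degree (x : G) : nat := #|[set z | adj x z]|.

Lemma sum_enum_val (F : G -> R) : \sum_(i < #|G|) F (enum_val i) = \sum_x F x.
Proof.
rewrite [RHS](reindex_onto (@enum_val G G) enum_rank) => [|x _]; last exact: enum_rankK.
by apply: eq_bigl => i; rewrite enum_valK eqxx.
Qed.

Lemma adjmx_sym : A^T = A.
Proof. by apply/matrixP => i j; rewrite !mxE adj_sym. Qed.

Lemma sum_adj_degree (x : G) : \sum_y (adj x y)%:R = (degree x)%:R :> R.
Proof.
rewrite -natr_sum; congr _%:R; rewrite /degree -sum1_card [RHS]big_mkcond /=.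
by apply: eq_bigr => y _; rewrite inE; case: adj.
Qed.

Lemma adjmx_row_sum i : \sum_j A i j = (degree (enum_val i))%:R.
Proof.
under eq_bigr do rewrite mxE.
by rewrite (sum_enum_val (fun y => (adj (enum_val i) y)%:R)) sum_adj_degree.
Qed.

Lemma adjmx_trace : \tr A = 0.
Proof. by apply: big1 => i _; rewrite mxE adj_irr. Qed.

Lemma adjmx_sqr i j : (A *m A) i j =
  #|[set z | adj (enum_val i) z && adj (enum_val j) z]|%:R.
Proof.
rewrite mxE; under eq_bigr do rewrite !mxE -natrM mulnb.
rewrite (sum_enum_val (fun z => (adj (enum_val i) z && adj z (enum_val j))%:R)).
rewrite -natr_sum; congr _%:R; rewrite -sum1_card [RHS]big_mkcond /=.
by apply: eq_bigr => z _; rewrite inE [adj z _]adj_sym; case: andb.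
Qed.

(** Counts ordered adjacent pairs: the fibre over an edge consists of its two orientations, distinct
    since there are no loops. *)
Lemma sum_degree : (\sum_(x : G) degree x = 2 * gsize G)%N.
Proof.
rewrite /gsize -sum1_card big_distrr /=.
transitivity (\sum_(u : G * G | adj u.1 u.2) 1)%N.
  rewrite -(pair_big_dep xpredT (fun x y : G => adj x y) (fun _ _ => 1%N)) /=.
  by apply: eq_bigr => x _; rewrite sum1_card /degree cardsE.
rewrite (partition_big (fun u : G * G => [set u.1; u.2]) (mem (edges G))) /=.
  apply: eq_bigr => e; rewrite inE => /existsP[x /existsP[y /andP[xy /eqP->]]].
  have xy' : x != y by apply: contraTneq xy => ->; rewrite adj_irr.
  rewrite sum1_card muln1.
  transitivity #|[set (x, y); (y, x)]|; last first.
    by rewrite cards2 xpair_eqE (negPf xy').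
  rewrite -cardsE; apply: eq_card => -[a b]; rewrite !inE /= !xpair_eqE.
  apply/idP/idP => [/andP[ab /eqP E]|/orP[]/andP[/eqP-> /eqP->]].
  - have /setP/(_ a) := E; have /setP/(_ b) := E.
    rewrite !inE !eqxx orbT /= => /esym/orP[]/eqP Eb /esym/orP[]/eqP Ea.
    + by move: ab; rewrite Ea Eb adj_irr.
    + by rewrite Ea Eb !eqxx orbT.
    + by rewrite Ea Eb !eqxx.
    + by move: ab; rewrite Ea Eb adj_irr.
  - by rewrite unfold_in /= xy eqxx.
  - by rewrite unfold_in /= adj_sym xy setUC eqxx.
move=> [a b] /= ab; rewrite inE; apply/existsP; exists a; apply/existsP.
by exists b; rewrite ab eqxx.
Qed.

Lemma degree_lt (x : G) : (degree x < #|G|)%N.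
Proof.
rewrite (cardD1 x) add1n ltnS /degree; apply: subset_leq_card.
apply/subsetP => y; rewrite !inE => xy; rewrite andbT.
by apply: contraTneq xy => ->; rewrite adj_irr.
Qed.

Lemma graph_iso_completeP n : #|G| = n ->
  (forall x y : G, x != y -> adj x y) <-> graph_iso G (complete_graph n).
Proof.
move=> nG; split=> [H|[f bf fE] x y xy].
  subst n; exists enum_rank; first exact: enum_rank_bij.
  move=> x y; rewrite /= (inj_eq enum_rank_inj).
  by case: eqVneq => [->|/H->]; rewrite ?adj_irr.
by rewrite -fE /= (inj_eq (bij_inj bf)).
Qed.

Lemma degree_complete : (forall x : G, degree x = #|G|.-1) ->
  forall x y : G, x != y -> adj x y.
Proof.
move=> H x y xy; have : [set z | adj x z] = [set~ x].
  apply/eqP; rewrite eqEcard cardsC1 -/(degree x) H leqnn andbT.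
  by apply/subsetP => z; rewrite !inE; apply: contraTneq => ->; rewrite adj_irr.
by move/setP/(_ y); rewrite !inE eq_sym xy.
Qed.

Lemma complete_degree : (forall x y : G, x != y -> adj x y) ->
  forall x, degree x = #|G|.-1.
Proof.
move=> H x; rewrite -(cardsC1 x) /degree; apply: eq_card => y; rewrite !inE.
by case: eqVneq => [->|yx]; rewrite ?adj_irr // H // eq_sym.
Qed.

Lemma copiesK2_degree k : graph_iso G (copiesK2 k) -> forall x, degree x = 1%N.
Proof.
move=> [f [g fK gK] fE] x; rewrite /degree.
(* The other end of the edge containing [f x], pulled back to [G]. *)
pose y := g ((f x).1, ~~ (f x).2); rewrite -(cards1 y); apply: eq_card => z.
rewrite !inE -fE /= -(can_eq fK) /y gK.
by case: (f x) (f z) => [i b] [j c]; rewrite xpair_eqE /= eq_sym; case: b c => [][].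
Qed.

(** The singular values are the square roots of the eigenvalues [r i ^+ 2] of [A^T *m A = A *m A].
    Keeping squares avoids absolute values. *)
Lemma schatten_normE p (P : 'M_#|G|) r : 1 <= p -> diagonalizes P A r ->
  powR (schatten_norm p G) p = \sum_i powR (r i ^+ 2) (p / 2).
Proof.
move=> p1 dA; rewrite /schatten_norm -powRrM mulVf; last by rewrite gt_eqF //; lra.
rewrite powRr1; last by rewrite sumr_ge0 // => s _; exact: powR_ge0.
rewrite /singular_values (perm_big _ (permEl (perm_sort _ _))) /= big_map.
have dAA := diagonalizes_mul dA dA.
rewrite adjmx_sym (perm_big _ (diagonalizes_spectrum dAA)) /= big_map big_enum.
apply: eq_bigr => i _.
by rewrite -expr2 -powR12_sqrt ?sqr_ge0 // -powRrM mulrC.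
Qed.

(** * Spectra of regular graphs *)

Section EqualityCase.
Variables (P : 'M[R[i]]_#|G|) (r : 'I_#|G| -> R) (k : nat).
Hypotheses (dA : diagonalizes P A r) (degG : forall x, degree x = k).
(** The squares of all eigenvalues add up to [#|G| * k]; this is their mean once one eigenvalue [k]
    is set aside. *)
Local Notation tau :=
  ((#|G|%:R * k%:R - k%:R ^+ 2) / (#|G|%:R - 1) : R).

Lemma regular_row_sum i : \sum_j A i j = k%:R.
Proof. by rewrite adjmx_row_sum degG. Qed.

Lemma sum_eigenvalues : \sum_i r i = 0.
Proof. by rewrite -(diagonalizes_trace dA) adjmx_trace. Qed.

Lemma sum_sqr_eigenvalues : \sum_i r i ^+ 2 = (2 * gsize G)%:R.
Proof.
under eq_bigr do rewrite expr2.
rewrite -(diagonalizes_trace (diagonalizes_mul dA dA)) -sum_degree natr_sum.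
rewrite -(sum_enum_val (fun x => (degree x)%:R)); apply: eq_bigr => i _.
by rewrite adjmx_sqr /degree; congr (_%:R); apply: eq_card => z; rewrite !inE andbb.
Qed.

Lemma regular_size : (2 * gsize G = #|G| * k)%N.
Proof.
rewrite -sum_degree; under eq_bigr do rewrite degG.
by rewrite sum_nat_const.
Qed.

Lemma mem_nontrivial_eigenvalues i0 x : r i0 = k%:R ->
  reflect (exists2 i, i != i0 & x = r i) (x \in nontrivial_eigenvalues R G k).
Proof.
move=> rk; rewrite /nontrivial_eigenvalues -rk.
rewrite (perm_mem (nontrivial_spectrum dA i0)).
apply: (iffP mapP) => -[j]; first by rewrite mem_filter => /andP[? _]; exists j.
  by move=> jj0 ->; exists j; rewrite // mem_filter jj0 mem_enum.
Qed.

(** Off the diagonal, [A *m A - tau%:M] counts common neighbours, and only its eigenvalue at [i0]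
    can be nonzero. *)
Lemma codegree_const i0 : r i0 = k%:R -> (forall i, i != i0 -> r i ^+ 2 = tau) ->
  forall x y x' y' : G, x != y -> x' != y' ->
    #|[set z | adj x z && adj y z]| = #|[set z | adj x' z && adj y' z]|.
Proof.
move=> rk rtau x y x' y' xy xy'.
have dB := diagonalizes_sub (diagonalizes_mul dA dA) (diagonalizes_scalar tau dA).
have BE i j : (A *m A - tau%:M) i j = (A *m A) i j - tau *+ (i == j).
  by rewrite !mxE.
suff B : forall i j i' j' : 'I_#|G|,
    (A *m A - tau%:M) i j = (A *m A - tau%:M) i' j'.
  have := B (enum_rank x) (enum_rank y) (enum_rank x') (enum_rank y').
  rewrite !BE !adjmx_sqr !enum_rankK.
  rewrite !(inj_eq enum_rank_inj) (negPf xy) (negPf xy') !mulr0n !subr0.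
  by move/eqP; rewrite eqr_nat => /eqP.
(* If [k ^+ 2 = tau], the eigenvalue [k] may be repeated and the all-ones vector need not lie along
   [i0], but then the whole matrix vanishes. Otherwise [k] is simple and [rank_one_const]
   applies. *)
have [rk0|rk0] := eqVneq (r i0 * r i0) tau.
  rewrite (diagonalizes_eq0 dB) => [i j i' j'|i]; first by rewrite !mxE.
  by have [->|ii0] := eqVneq i i0; rewrite ?rk0 -?expr2 ?rtau ?subrr.
apply: (rank_one_const dB (i0 := i0)) => i ii0; first by rewrite -expr2 rtau ?subrr.
have /(_ i)/eqP := (row_sum_constP adjmx_sym dA k%:R).1 regular_row_sum.
rewrite mulf_eq0 => /orP[/eqP//|]; rewrite subr_eq0 => /eqP rik.
by case/eqP: rk0; rewrite -(rtau i) // rik rk expr2.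
Qed.

Lemma noncomplete_strongly_regular i0 (theta : R) :
  r i0 = k%:R -> (forall i, i != i0 -> r i ^+ 2 = tau) ->
  (0 < k)%N -> theta ^+ 2 = tau -> 0 <= theta ->
  ~ (forall x y : G, x != y -> adj x y) ->
  exists a c, strongly_regular G k a c
    /\ nontrivial_eigenvalues R G k =i [:: theta; - theta].
Proof.
move=> rk rtau k0 thetaE theta0 ncG.
have N1 : (1 : R) < #|G|%:R.
  rewrite ltr1n; case: (ltnP 1 #|G|) => // N1; case: ncG => x y.
  by rewrite (fintype_le1P N1 x y) eqxx.
have kR : 0 < k%:R :> R by rewrite ltr0n.
have rE i : i != i0 -> r i = theta \/ r i = - theta.
  by move/rtau/eqP; rewrite -thetaE eqf_sqr => /orP[]/eqP->; [left|right].
have r0 := sum_eigenvalues; rewrite (bigD1 i0) //= rk in r0.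
have cardI : \sum_(i : 'I_#|G| | i != i0) theta = (#|G|%:R - 1) * theta.
  rewrite sumr_const cardC1 card_ord -[_ *+ _.-1]mulr_natl -subn1 natrB //.
  by rewrite -(ler_nat R) ltW.
(* If [theta] were missing, zero trace would give [k = (#|G| - 1) * theta]; squaring and using
   [theta ^+ 2 = tau] yields [k = #|G| - 1], a complete graph. *)
have pos : exists2 i, i != i0 & r i = theta.
  have [i /andP[ii0 /eqP]|none] := pickP (fun i => (i != i0) && (r i == theta)).
    by exists i.
  case: ncG; apply: degree_complete => x; rewrite degG.
  have E : k%:R = (#|G|%:R - 1) * theta.
    rewrite -cardI; apply/eqP; rewrite -subr_eq0 -sumrN -[X in _ == X]r0.
    apply/eqP; congr (_ + _); apply: eq_bigr => i ii0.
    by have := none i; case: (rE i ii0) => ->; rewrite ii0 /= ?eqxx.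
  have : k%:R * (#|G|%:R * ((#|G|%:R - 1) - k%:R)) = 0 :> R.
    have : (k%:R : R) ^+ 2 = (#|G|%:R - 1) * (#|G|%:R * k%:R - k%:R ^+ 2).
      rewrite {1}E exprMn thetaE; field; lra.
    lra.
  move/eqP; rewrite !mulf_eq0 (gt_eqF kR) gt_eqF /=; last lra.
  rewrite subr_eq0 eq_sym -(natrB _ (n := 1)) ?eqr_nat ?subn1 => [/eqP//|].
  by rewrite -(ler_nat R) ltW.
(* If [- theta] were missing, the trace would be at least [k > 0]. *)
have neg : exists2 i, i != i0 & r i = - theta.
  have [i /andP[ii0 /eqP]|none] := pickP (fun i => (i != i0) && (r i == - theta)).
    by exists i.
  have : 0 <= \sum_(i < #|G| | i != i0) r i.
    apply: sumr_ge0 => i ii0; have := none i.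
    by case: (rE i ii0) => ->; rewrite ii0 //= eqxx.
  lra.
have [xy xyN] : exists xy : G * G, xy.1 != xy.2.
  have : (1 < #|G|)%N by rewrite -(ltr_nat R).
  by case/card_gt1P => x [y [_ _ xy]]; exists (x, y).
(* All pairs of distinct vertices have equally many common neighbours, so one pair supplies both
   parameters. *)
exists #|[set z | adj xy.1 z && adj xy.2 z]|, #|[set z | adj xy.1 z && adj xy.2 z]|.
split.
  split=> [x|x y axy|x y nxy _]; first exact: degG.
  - apply: (codegree_const rk rtau) => //.
    by apply: contraTneq axy => ->; rewrite adj_irr.
  - exact: (codegree_const rk rtau).
move=> x; rewrite !inE; apply/(mem_nontrivial_eigenvalues _ rk)/orP.
  by case=> i ii0 ->; case: (rE i ii0) => ->; [left|right].
by case=> /eqP->; [case: pos|case: neg] => i ii0 <-; exists i.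
Qed.

(** The other eigenvalues are all [-1]: the first two power sums make the sum of the
    [(r i + 1) ^+ 2] vanish. *)
Lemma complete_eigenvalues i0 : r i0 = k%:R ->
  (forall x y : G, x != y -> adj x y) -> (1 < #|G|)%N ->
  forall i, i != i0 -> r i ^+ 2 = tau.
Proof.
move=> rk cG N1.
have kE : k%:R = #|G|%:R - 1 :> R.
  by rewrite -(degG (enum_val i0)) complete_degree // -subn1 natrB // ltnW.
have M0 : 0 < #|G|%:R - 1 :> R by rewrite subr_gt0 ltr1n.
have -> : tau = 1 by rewrite kE; field; lra.
have : \sum_(i < #|G| | i != i0) (r i + 1) ^+ 2 == 0.
  have s1 := sum_eigenvalues; have s2 := sum_sqr_eigenvalues.
  rewrite (bigD1 i0) //= rk in s1; rewrite (bigD1 i0) //= rk in s2.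
  rewrite regular_size natrM in s2.
  under eq_bigr do rewrite sqrrD1.
  rewrite !big_split /= sumr_const cardC1 card_ord -[1 *+ _]mulr_natl mulr1 -subn1.
  rewrite natrB ?(ltnW N1) //; apply/eqP; move: s1 s2; rewrite kE; lra.
rewrite psumr_eq0 => [/allP H i ii0|i _]; last exact: sqr_ge0.
have := H i (mem_index_enum _); rewrite ii0 sqrf_eq0 addr_eq0 => /eqP->.
by rewrite sqrrN expr1n.
Qed.

End EqualityCase.

(** In a 1-regular graph distinct vertices have no common neighbour, so [A *m A] is the identity. *)
Lemma matching_eigenvalues (P : 'M_#|G|) r :
  diagonalizes P A r -> (forall x, degree x = 1%N) -> forall i, r i ^+ 2 = 1.
Proof.
move=> dA deg1 i; have [Pu _] := dA.
have d1 := diagonalizes_scalar 1 dA.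
have dB := diagonalizes_mul dA dA.
have AA : A *m A = 1%:M.
  apply/matrixP => x y; rewrite adjmx_sqr mxE -(inj_eq enum_val_inj).
  case: eqVneq => [->|xy].
    rewrite -[RHS]/(1%N%:R) -(deg1 (enum_val y)); congr (_%:R).
    by apply: eq_card => z; rewrite !inE andbb.
  rewrite mulr0n; apply/eqP; rewrite pnatr_eq0 cards_eq0; apply/eqP/setP => z.
  rewrite !inE; apply/negbTE/negP => /andP[xz yz].
  have /eqP/cards1P[w wE] := deg1 z.
  have /setP Hx := wE; have := Hx (enum_val x); have := Hx (enum_val y).
  rewrite !inE ![adj z _]adj_sym xz yz => /esym/eqP Ey /esym/eqP Ex.
  by move: xy; rewrite Ex Ey eqxx.
have dC := diagonalizes_sub dB (diagonalizes_scalar 1 dA).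
(* The square of the zero matrix [A *m A - 1] has trace the sum of the [(r i ^+ 2 - 1) ^+ 2]. *)
have := diagonalizes_trace (diagonalizes_mul dC dC).
rewrite AA subrr mul0mx mxtrace0 => /esym/eqP.
rewrite psumr_eq0 => [/allP/(_ i (mem_index_enum _))|j _]; last exact: sqr_ge0.
by rewrite /= mulf_eq0 orbb subr_eq0 => /eqP.
Qed.

End Adjacency.

(** * The norm bound and its extremal graphs *)

Lemma sum_degree_le (G : sgraph) : (2 * gsize G <= #|G| * #|G|.-1)%N.
Proof.
rewrite -sum_degree -sum_nat_const; apply: leq_sum => x _.
by rewrite -ltnS (leq_trans (degree_lt x)) // leqSpred.
Qed.

Lemma graph_iso_empty (G H : sgraph) : #|G| = 0%N -> #|H| = 0%N -> graph_iso G H.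
Proof.
move=> G0 H0.
have nG (x : G) : False by have := fintype0 x; rewrite G0.
have nH (x : H) : False by have := fintype0 x; rewrite H0.
exists (fun x => match nG x with end); last by move=> x; case: (nG x).
by exists (fun x => match nH x with end) => x; [case: (nG x)|case: (nH x)].
Qed.

Unset Implicit Arguments.
Set Strict Implicit.

Theorem theorem8 (R : realType) (p : R) (G : sgraph) (n m : nat)
    (p_ge1 : 1 <= p) (p_le2 : p <= 2)
    (G_order : gorder G = n) (G_size : gsize G = m)
    (m_ge : n%:R / 2 <= m%:R :> R) :
  let d : R := 2 * m%:R / n%:R in
  let bound : R := powR d p
    + powR (n%:R - 1) (1 - p / 2) * powR (2 * m%:R - d ^+ 2) (p / 2) in
  let theta : R := powR ((2 * m%:R - d ^+ 2) / (n%:R - 1)) (1 / 2) in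
  powR (schatten_norm p G) p <= bound
  /\ (p < 2 ->
      (powR (schatten_norm p G) p = bound
       <-> [\/ ~~ odd n /\ graph_iso G (copiesK2 n./2),
               graph_iso G (complete_graph n)
             | ~ graph_iso G (complete_graph n)
               /\ exists k a c : nat,
                    strongly_regular G k a c
                    /\ nontrivial_eigenvalues R G k =i [:: theta; - theta]])).
Proof.
move=> d bound theta; rewrite /gorder in G_order; subst n m.
have [P [r dA]] := diagonalizes_symmetric (adjmx_sym R G).
have symA := adjmx_sym R G.
rewrite (schatten_normE p_ge1 dA).
have [N0|N0] := posnP #|G|.
  (* In order zero, division by zero makes [d] and the bound vanish, and the empty graph is
     [copiesK2 0]. *)
  have m0 : gsize G = 0%N.
    by have := sum_degree_le G; rewrite N0; case: (gsize G).
  have bound0 : bound = 0.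
    rewrite /bound /d N0 m0 !(mulr0, mul0r) expr0n subrr /= !powR0; lra.
  rewrite bound0 big1 => [|i _]; last by have := ltn_ord i; rewrite {2}N0.
  split=> // _; split=> // _; constructor 1; rewrite N0; split=> //.
  by apply: graph_iso_empty => //; rewrite card_prod card_ord.
have NR : 0 < #|G|%:R :> R by rewrite ltr0n.
have mE : 2 * (gsize G)%:R = #|G|%:R * d by rewrite /d mulrCA divff ?mulr1 ?gt_eqF.
have sumA : \sum_i \sum_j adjmx R G i j = #|G|%:R * d.
  rewrite -mE -natrM -sum_degree natr_sum -(sum_enum_val (fun x => (degree x)%:R)).
  by apply: eq_bigr => i _; exact: adjmx_row_sum.
(* This is [m_ge]. Together with [dN] it excludes order one, so [#|G| - 1] is positive. *)
have d1 : 1 <= d by rewrite /d ler_pdivlMr //; lra.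
have dN : d < #|G|%:R.
  have : d <= #|G|.-1%:R.
    rewrite /d ler_pdivrMr // -!natrM ler_nat [X in (_ <= X)%N]mulnC.
    exact: sum_degree_le.
  by move/le_lt_trans; apply; rewrite ltr_nat prednK.
have N1 : 0 < #|G|%:R - 1 :> R by lra.
have q0 : 0 < p / 2 by lra.
have q1 : p / 2 <= 1 by lra.
have sumr2 : \sum_i r i ^+ 2 = #|'I_#|G| |%:R * d.
  by rewrite (sum_sqr_eigenvalues dA) card_ord natrM mE.
have boundE : bound = powR d (2 * (p / 2))
    + powR (#|'I_#|G| |%:R - 1) (1 - p / 2)
      * powR (#|'I_#|G| |%:R * d - d ^+ 2) (p / 2).
  by rewrite /bound mE card_ord; congr (powR d _ + _); field.
have [i0 [rmax]] := mean_le_eigenvalue dA N0.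
rewrite sumA ler_pM2l // => dr.
have r_ge0 i : 0 <= r i ^+ 2 by exact: sqr_ge0.
have d0 : 0 <= d by lra.
have dr2 : d ^+ 2 <= r i0 ^+ 2 by rewrite ler_pXn2r ?nnegrE // (le_trans d0).
have dN' : d < #|'I_#|G| |%:R by rewrite card_ord.
have [le eq] := sum_powR_le q0 q1 d1 dN' r_ge0 sumr2 dr2.
(* At [p = 2] both sides equal [2 * m] for every graph; equality is informative only for [p < 2],
   where the tangent inequalities are strict. *)
rewrite -boundE in le eq; split=> // p2.
have {}q1 : p / 2 < 1 by lra.
pose tau := (#|G|%:R * d - d ^+ 2) / (#|G|%:R - 1).
have T0 : 0 < #|G|%:R * d - d ^+ 2 by rewrite expr2 -mulrBl mulr_gt0 //; lra.
have theta2 : theta ^+ 2 = tau.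
  rewrite /theta mE div1r powR12_sqrt ?sqr_sqrtr //; exact/ltW/divr_gt0.
have theta0 : 0 <= theta by exact: powR_ge0.
(* The converse reduces, for each of the three families, to finding one eigenvalue [d] and checking
   that the others have square [tau]. *)
have flat j0 : r j0 = d -> (forall i, i != j0 -> r i ^+ 2 = tau) ->
    \sum_i powR (r i ^+ 2) (p / 2) = bound.
  move=> rj0 rtau; rewrite boundE; apply: (sum_powR_const (i0 := j0)) => //.
  - by rewrite rj0.
  - by move=> i /rtau ->; rewrite card_ord.
  - by rewrite card_ord ltW.
  - by rewrite card_ord -(ltr_nat R); lra.
split=> [E|].
  have [rd rtau] := eq q1 E; rewrite card_ord -/tau in rtau.
  have {}rd : r i0 = d.
    by apply/eqP; rewrite -(eqrXn2 (n := 2)) ?rd // (le_trans d0).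
  (* The Rayleigh bound is attained, so the all-ones vector is an eigenvector and [G] is regular. *)
  have Acst i : \sum_j adjmx R G i j = d.
    by rewrite -rd; apply: (mean_eq_eigenvalue symA dA rmax); rewrite rd.
  pose k := degree (enum_val i0).
  have kd : k%:R = d by rewrite -(adjmx_row_sum R i0).
  have degG (x : G) : degree x = k.
    apply/eqP; rewrite -(eqr_nat R) kd -(Acst (enum_rank x)) adjmx_row_sum.
    by rewrite enum_rankK.
  have [/forallP cG|ncG] :=
      boolP [forall x : G, forall y : G, (x != y) ==> adj x y].
    constructor 2; apply/graph_iso_completeP => // x y.
    by have /forallP/(_ y)/implyP := cG x.
  have {}ncG : ~ forall x y : G, x != y -> adj x y.
    by move=> cG; case/negP: ncG; do 2 apply/forallP => ?; apply/implyP/cG.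
  constructor 3; split; first by move/graph_iso_completeP => /(_ erefl).
  rewrite /tau -kd in rd rtau theta2.
  exists k; apply: (noncomplete_strongly_regular dA degG rd) => //.
  by rewrite -(ltr_nat R) kd; lra.
have reg k : (forall x : G, degree x = k) -> k%:R = d /\ exists j0, r j0 = d.
  move=> degG.
  have kd : k%:R = d.
    apply: (mulfI (lt0r_neq0 NR)).
    by rewrite -mE -!natrM (regular_size degG).
  split=> //; apply: (row_sum_const_eigenvalue symA dA N0) => i.
  by rewrite (regular_row_sum _ degG).
case=> [[_ /copiesK2_degree deg1]|/(graph_iso_completeP erefl) cG|].
- have [kd [j0 rj0]] := reg _ deg1.
  (* For degree 1, [tau] is [(#|G| - 1) / (#|G| - 1) = 1]. *)
  apply: (flat j0) => // i _; rewrite (matching_eigenvalues dA deg1).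
  by rewrite /tau -kd mulr1 expr1n divff // gt_eqF.
- have degG := complete_degree cG; have [kd [j0 rj0]] := reg _ degG.
  apply: (flat j0) => //; rewrite /tau -kd; rewrite -kd in rj0.
  by apply: (complete_eigenvalues dA degG rj0 cG); rewrite -(ltr_nat R); lra.
- move=> [_ [k [a [c [[degG _ _] spec]]]]].
  have [kd [j0 rj0]] := reg _ degG; apply: (flat j0) => // i ij0.
  rewrite -kd in rj0.
  have : r i \in nontrivial_eigenvalues R G k.
    by apply/(mem_nontrivial_eigenvalues dA _ rj0); exists i.
  by rewrite spec !inE => /orP[]/eqP->; rewrite ?sqrrN.
Qed.
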